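(* Let $G$ be a Gårding elliptic operator on $Q(V)$ of degree $d\ge1$, and let $\mathcal A_G=\operatorname{int}\mathcal C_G^{(1)}$. Then $(G,\mathcal A_G)$ satisfies: (A1) $\mathcal A_G\neq\varnothing$ and $\mathcal A_G+Q(V)^+\subset\mathcal A_G$; (A2) $G(A+P)>G(A)$ for every $A\in\mathcal A_G$ and $P\in Q(V)^{++}$; (A3) for every $A_0\in\partial\mathcal A_G$, $\limsup_{A\in\mathcal A_G,\,A\to A_0}G(A)\le0$. For $A\in\mathcal C_G^{(1)}$ and $P\in Q(V)^+$, $$G(A+P)-G(A)\ge G^{\mathrm{top}}(P).$$ Moreover, $\mathcal C_G^{(1)}\cap\{G>0\}=\mathcal C_G$.
   Context: $V$ is a finite-dimensional complex vector space, $Q(V)$ the real vector space of Hermitian forms on $V$, and $Q(V)^+$, $Q(V)^{++}$ the semipositive and positive definite forms. $G^{\mathrm{top}}$ is the top-degree homogeneous part of $G$; $\partial_P$ is the directional derivative. Let $W$ be a finite-dimensional real vector space and $\mathcal K\subsetneq W$ a closed convex cone with nonempty interior. A set $\mathcal U\subseteq W$ satisfies the $\mathcal K$-conic ray test if $\mathcal U+\mathcal K\subseteq\mathcal U$. For nonzero $F\in\mathbb R[W]$, $\{F>0\}$ has at most one connected component satisfying the $\mathcal K$-conic ray test; if it exists it is denoted $\mathcal C_F^{\mathcal K}$ (for a positive constant $F$, $\mathcal C_F^{\mathcal K}=W$). A nonzero $F$ is $\mathcal K$-Gårding (recursively on degree) if $\mathcal C_F^{\mathcal K}$ exists and, whenever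 $\deg F\ge1$, for every $P\in\mathcal K$ with $\partial_PF\not\equiv0$ the polynomial $\partial_PF$ is $\mathcal K$-Gårding and $\mathcal C_F^{\mathcal K}\subseteq\mathcal C_{\partial_PF}^{\mathcal K}$. A polynomial $G:Q(V)\to\mathbb R$ is a Gårding elliptic operator if it is $Q(V)^+$-Gårding; then $\mathcal C_G=\mathcal C_G^{Q(V)^+}$ and $\mathcal C_G^{(1)}=\bigcap\mathcal C_{\partial_PG}$, the intersection over all $P\in Q(V)^+$ with $\partial_PG\not\equiv0$. *)

(* Defs.v *)
From HB Require Import structures.
From mathcomp Require Import all_boot all_order all_algebra.
From mathcomp Require Import all_classical all_reals topology normedtype.
From mathcomp Require Import complex.
(* The notations of [mpoly] clash with those of MathComp-Analysis. *)
From mathcomp Require Import -(notations) freeg mpoly.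

Set Implicit Arguments.
Unset Strict Implicit.
Unset Printing Implicit Defensive.

Import Order.TTheory GRing.Theory Num.Theory numFieldNormedType.Exports.

Local Open Scope classical_set_scope.
Local Open Scope ring_scope.

(* Polynomials on a finite-dimensional real vector space W, with its          *)
(* canonical topology. Both are set up in the coordinates of the basis        *)
(* [vbasis {:W}]; another basis would only change them by an invertible       *)
(* linear substitution, which affects none of the notions below.              *)

Definition coords (R : realType) (W : vectType R) : W -> 'rV[R]_(\dim {:W}) :=
  passmx.rVof (vbasis {:W}).

Definition vtop (R : realType) (W : vectType R) : topologicalType :=
  initial_topology (@coords R W).

Definition polyOn (R : realType) (W : vectType R) := mpoly (\dim {:W}) R.

HB.instance Definition _ (R : realType) (W : vectType R) :=
  GRing.ComAlgebra.on (@polyOn R W).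

Section PolynomialsOn.
Context (R : realType) (W : vectType R).
Implicit Types (F : polyOn W) (K : set W) (P A : W).

Definition peval F A : R := meval (fun i => coords A 0 i) F.

(* The zero polynomial is given degree 0. *)
Definition pdeg F : nat := (mmeasure mdeg F).-1.

Definition ptop F : polyOn W := pihomog mdeg (pdeg F) F.

Definition pderiv P F : polyOn W := \sum_i coords P 0 i *: mderiv i F.

Definition positivity_set F : set W := [set A | 0 < peval F A].

Definition conic_ray_test K (U : set W) : Prop :=
  forall A P, U A -> K P -> U (A + P).

Definition conic_component K F (C : set W) : Prop :=
  (exists2 A : W, positivity_set F A &
     C = connected_component (positivity_set F : set (vtop W)) A)
  /\ conic_ray_test K C.

(* For K a closed convex cone with nonempty interior there is at most one     *)
(* conic component, and [conic_set K F] is that component; it is set to be    *)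
(* empty when there is none.                                                  *)
Definition conic_set K F : set W := xget set0 (conic_component K F).

(* The recursion is well founded since [pderiv] lowers the degree.            *)
Inductive garding K : polyOn W -> Prop :=
  Garding F of
    F != 0 &
    (exists C, conic_component K F C) &
    ((1 <= pdeg F)%N ->
      forall P, K P -> pderiv P F != 0 -> garding K (pderiv P F)) &
    ((1 <= pdeg F)%N ->
      forall P, K P -> pderiv P F != 0 ->
        conic_set K F `<=` conic_set K (pderiv P F)) :
  garding K F.

Definition conic_set1 K F : set W :=
  \bigcap_(P in [set P | K P /\ pderiv P F != 0]) conic_set K (pderiv P F).

End PolynomialsOn.

Definition boundary (T : topologicalType) (A : set T) : set T :=
  closure A `\` interior A.

(* Hermitian forms on a complex vector space V, linear in the first argument. *)

Definition hermitian_form (R : realType) (V : lmodType R[i])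
    (B : V -> V -> R[i]) : Prop :=
  (forall v, scalar (fun u => B u v)) /\ (forall u v, B u v = (B v u)^*).

Definition hermitian_pred (R : realType) (V : lmodType R[i])
  : {pred (V -> V -> R[i])} := fun B => `[< hermitian_form B >].

Record hform (R : realType) (V : lmodType R[i]) := HForm {
  hform_val :> V -> V -> R[i];
  hform_valP : hermitian_pred hform_val }.

HB.instance Definition _ (R : realType) (V : lmodType R[i]) :=
  [isSub for @hform_val R V].
HB.instance Definition _ (R : realType) (V : lmodType R[i]) :=
  [Choice of hform V by <:].

Section HermitianLmodule.
Context (R : realType) (V : lmodType R[i]).
Implicit Types (B : hform V) (u v : V).

Lemma hform_ext B1 B2 : (forall u v, B1 u v = B2 u v) -> B1 = B2.
Proof.
move=> e; apply: val_inj; apply: funext => u; apply: funext => v; exact: e.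
Qed.

Lemma hformC B u v : B u v = (B v u)^*.
Proof. by case: B => B /= /asboolP[]. Qed.

Lemma hform_linearl B v : scalar (fun u => B u v).
Proof. by case: B => B /= /asboolP[]. Qed.

Lemma hermitian_zmod_closed : zmod_closed (@hermitian_pred R V).
Proof.
split=> [|B1 B2 /asboolP[l1 h1] /asboolP[l2 h2]]; apply/asboolP; split.
- by move=> v a x y; rewrite /= mulr0 addr0.
- by move=> u v; rewrite conjC0.
- move=> v a x y; change (B1 (a *: x + y) v - B2 (a *: x + y) v =
    a * (B1 x v - B2 x v) + (B1 y v - B2 y v)).
  by rewrite l1 l2 opprD mulrBr addrACA.
- move=> u v; change (B1 u v - B2 u v = (B1 v u - B2 v u)^*).
  by rewrite (h1 u v) (h2 u v) rmorphB.
Qed.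

HB.instance Definition _ :=
  GRing.isZmodClosed.Build _ (@hermitian_pred R V) hermitian_zmod_closed.
HB.instance Definition _ := [SubChoice_isSubZmodule of hform V by <:].

Lemma hformD B1 B2 u v : (B1 + B2) u v = B1 u v + B2 u v.
Proof. by []. Qed.

Lemma hscale_subproof (r : R) B :
  hermitian_pred (fun u v => r%:C%C * B u v).
Proof.
apply/asboolP; split=> [v a x y|u v].
  by rewrite hform_linearl mulrDr mulrCA.
by rewrite rmorphM /= -hformC; congr (_ * _); apply/eqP; rewrite eq_complex /= oppr0 !eqxx.
Qed.

Definition hscale r B : hform V := HForm (hscale_subproof r B).

Lemma hscaleA r s B : hscale r (hscale s B) = hscale (r * s) B.
Proof. by apply: hform_ext => u v /=; rewrite mulrA rmorphM. Qed.

Lemma hscale1 : left_id 1 hscale.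
Proof. by move=> B; apply: hform_ext => u v /=; rewrite mul1r. Qed.

Lemma hscaleDr : right_distributive hscale +%R.
Proof. move=> r B1 B2; apply: hform_ext => u v; exact: mulrDr. Qed.

Lemma hscaleDl B : {morph hscale^~ B : r s / r + s}.
Proof.
move=> r s; apply: hform_ext => u v; rewrite hformD /=.
by rewrite rmorphD mulrDl.
Qed.

HB.instance Definition _ := GRing.Zmodule_isLmodule.Build R (hform V)
  hscaleA hscale1 hscaleDr hscaleDl.

Lemma hformZ (r : R) B u v : (r *: B) u v = r%:C%C * B u v.
Proof. by []. Qed.

End HermitianLmodule.

(* A Hermitian form is determined by the real parts of the upper triangle of  *)
(* its Gram matrix and the imaginary parts of the strict lower triangle.      *)
Section HermitianVector.
Context (R : realType) (V : vectType R[i]).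
Let n := \dim {:V}.
Let e (i : 'I_n) : V := (vbasis {:V})`_i.
Let x (u : V) (i : 'I_n) : R[i] := coord (vbasis {:V}) i u.

Definition gram (B : hform V) : 'M[R]_n := \matrix_(i, j)
  if (i <= j)%N then complex.Re (B (e i) (e j)) else complex.Im (B (e i) (e j)).

Definition gram_entry (M : 'M[R]_n) (i j : 'I_n) : R[i] :=
  if i == j then Complex (M i i) 0 else
  if (i < j)%N then Complex (M i j) (- M j i) else Complex (M j i) (M i j).

Lemma gram_entryC M i j : gram_entry M i j = (gram_entry M j i)^*.
Proof.
rewrite /gram_entry; case: eqVneq => [->|ne]; first by rewrite /Num.conj /= oppr0.
case: (ltngtP i j) => [lt|lt|/val_inj/eqP]; last by rewrite (negPf ne).
- by rewrite /Num.conj /=.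
- by rewrite /Num.conj /= opprK.
Qed.

Lemma gram_form_subproof M : hermitian_pred
  (fun u v : V => \sum_i \sum_j x u i * (x v j)^* * gram_entry M i j).
Proof.
apply/asboolP; split=> [v a y z|u v].
  rewrite mulr_sumr -big_split; apply: eq_bigr => i _ /=.
  rewrite mulr_sumr -big_split; apply: eq_bigr => j _ /=.
  by rewrite /x linearP /= !mulrDl !mulrA.
rewrite exchange_big /= rmorph_sum; apply: eq_bigr => j _.
rewrite rmorph_sum; apply: eq_bigr => i _.
by rewrite gram_entryC !rmorphM /= conjCK [_ * (x v j)^*]mulrC.
Qed.

Definition gram_form M : hform V := HForm (gram_form_subproof M).

Lemma gram_linear : linear (mxvec \o gram).
Proof.
move=> a B1 B2 /=; rewrite -linearP; congr mxvec; apply/matrixP => i j.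
rewrite !mxE hformD hformZ; case: ifP => _.
  by case: (B1 _ _) (B2 _ _) => [r s] [r' s'] /=; rewrite mul0r subr0.
by case: (B1 _ _) (B2 _ _) => [r s] [r' s'] /=; rewrite mul0r addr0.
Qed.

Lemma gram_entryK B i j : gram_entry (gram B) i j = B (e i) (e j).
Proof.
rewrite /gram_entry !mxE; have h := hformC B (e i) (e j).
case: eqVneq => [ij|ne].
  move: h; rewrite -ij leqnn; case: (B _ _) => r s [] /eqP.
  by rewrite -addr_eq0 -mulr2n mulrn_eq0 /= => /eqP ->.
case: (ltngtP i j) => [lt|lt|/val_inj/eqP]; last by rewrite (negPf ne).
- by rewrite h; case: (B _ _).
- by rewrite h; case: (B _ _) => r s /=; rewrite /Num.conj /=.
Qed.

Lemma gramK : cancel gram gram_form.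
Proof.
move=> B; apply: hform_ext => u v /=.
have lin w (c : 'I_n -> R[i]) : B (\sum_i c i *: e i) w = \sum_i c i * B (e i) w.
  apply: (big_rec2 (fun q p => B q w = p)) => [|i q p _ <-]; last first.
    exact: hform_linearl.
  have := hform_linearl B w (-1) 0 0.
  by rewrite scaler0 addr0 mulN1r addNr.
have uE w : w = \sum_i x w i *: e i by apply: coord_vbasis; rewrite memvf.
rewrite [in RHS](uE u) lin; apply: eq_bigr => i _.
rewrite hformC [in RHS](uE v) lin rmorph_sum mulr_sumr; apply: eq_bigr => j _.
by rewrite gram_entryK rmorphM /= -hformC mulrA.
Qed.

Lemma gram_formK : cancel gram_form gram.
Proof.
move=> M.
have xe i j : x (e i) j = (i == j)%:R.
  by rewrite /x /e coord_free // (basis_free (vbasisP _)).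
have fE i j : gram_form M (e i) (e j) = gram_entry M i j.
  rewrite /= (bigD1 i) //= (bigD1 j) //= !xe !eqxx conjC1 !mul1r.
  rewrite !big1 ?addr0 // => [k nk|k nk].
    by rewrite big1 // => l _; rewrite xe eq_sym (negPf nk) !mul0r.
  by rewrite xe eq_sym (negPf nk) conjC0 mulr0 mul0r.
apply/matrixP => i j; rewrite mxE fE /gram_entry.
by case: eqVneq => [->|ne]; [rewrite leqnn|
  case: (ltngtP i j) => [lt|lt|/val_inj/eqP]; last by rewrite (negPf ne)].
Qed.

Lemma hform_vector_axiom : Vector.axiom (n * n) (hform V).
Proof.
exists (mxvec \o gram); first exact: gram_linear.
exists (gram_form \o vec_mx) => y /=; first by rewrite mxvecK gramK.
by rewrite gram_formK vec_mxK.
Qed.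

HB.instance Definition _ :=
  Lmodule_hasFinDim.Build R (hform V) hform_vector_axiom.

End HermitianVector.

Section GardingElliptic.
Context (R : realType) (V : vectType R[i]).

Definition semipositive : set (hform V) :=
  [set P | forall v : V, 0 <= P v v].

Definition positive : set (hform V) :=
  [set P | forall v : V, v != 0 -> 0 < P v v].

Definition garding_elliptic (G : polyOn (hform V)) : Prop :=
  garding semipositive G.

Definition elliptic_set (G : polyOn (hform V)) : set (hform V) :=
  conic_set semipositive G.

Definition elliptic_set1 (G : polyOn (hform V)) : set (hform V) :=
  conic_set1 semipositive G.

Definition admissible (G : polyOn (hform V)) : set (vtop (hform V)) :=
  interior (elliptic_set1 G : set (vtop (hform V))).

End GardingElliptic.

(* Main.v *)
Require Import Defs.
From HB Require Import structures.
From mathcomp Require Import all_boot all_order all_algebra.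
From mathcomp Require Import all_classical all_reals ereal topology normedtype.
From mathcomp Require Import complex zify ring.
From mathcomp Require Import -(notations) mpoly.

Import Order.TTheory GRing.Theory Num.Theory numFieldNormedType.Exports.

Local Open Scope classical_set_scope.
Local Open Scope ring_scope.

(** Everything is read off restrictions of [G] to lines.  The coefficient of
    [t^k] in [t |-> G(A + tP)] is [(d_P)^k G (A) / k!].  If [P] lies in the cone
    and [A] in [C_G^(1)], then for [k >= 1] the polynomial [(d_P)^k G] is either
    zero or Garding with [A] in its conic component, so these coefficients are
    all nonnegative ([coef_restrict_ge0]).  Hence [G(A + tP) - G(A)] is bounded
    below by each single term with [k >= 1] ([coef_le_increment]):

    - the term of degree [deg G] at [t = 1] is [G^top(P)], the announced lower
      bound;
    - the linear term is [d_P G (A)].  It is positive when [P] is positive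
      definite, because [d_P G] then cannot vanish identically: otherwise, for
      [Q] in the cone and [t] large enough that [tP - Q] is in the cone, both
      [d_Q G] and [d_(tP - Q) G = - d_Q G] would be Garding if nonzero, and
      positive at a common point of their conic components, which always meet
      ([pderiv_order_unit_neq0]).  So [d_Q G = 0] for all [Q] of the cone, which
      spans, and [G] would be constant.  This is (A2).

    In particular [G] is nondecreasing along the cone from every point [A] of
    [C_G^(1)].  If moreover [G(A) > 0], a segment in a suitable direction of the
    cone joins [A] to [C_G] without leaving [{G > 0}], so [A] belongs to the
    component [C_G].  This is the equality [conic_set1_gt0].

    The topology enters only through the facts that polynomials are continuous,
    that segments are connected and that points have arbitrarily small
    star-shaped neighbourhoods.  Thus [C_G] is open, which makes the interior of
    [C_G^(1)] nonempty; and a boundary point of that interior where [G > 0]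
    would be joined inside [{G > 0}] to points of [C_G^(1)], hence would lie in
    the open set [C_G], a contradiction which gives (A3).

    Two facts about the cone of semipositive forms are used: it generates the
    space, and its positive definite elements are order units
    ([positive_order_unit]).  The second holds because the squared coordinates
    of a vector [v], hence all Hermitian forms at [v], are bounded by multiples
    of [P(v, v)] when [P] is positive definite. *)

(** * Restriction of a polynomial to a line *)

Section Restriction.
Context {R : realType} {W : vectType R}.
Implicit Types (F : polyOn W) (A P Q : W) (t : R).

Lemma vecK : cancel (passmx.vecof (vbasis {:W})) (@coords R W).
Proof. exact: passmx.vecofK (vbasisP _). Qed.

Lemma coordsE A P t : coords (A + t *: P) = coords A + t *: coords P.
Proof. by rewrite /coords addrC passmx.rVof_linear addrC. Qed.

Definition restrict F A P : {poly R} :=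
  mmap polyC (fun i => (coords A 0 i)%:P + coords P 0 i *: 'X) F.

Lemma horner_restrict F A P t : (restrict F A P).[t] = peval F (A + t *: P).
Proof.
rewrite /restrict /peval /meval /mmap horner_sum; apply: eq_bigr => m _.
rewrite hornerM hornerC /mmap1 horner_prod; congr (_ * _).
apply: eq_bigr => i _.
by rewrite horner_exp !hornerE coordsE !mxE mulrC.
Qed.

(** The chain rule. Both sides are derivations along the same ring morphism,
    so it is enough to compare them on the variables. *)
Lemma deriv_restrict F A P :
  (restrict F A P)^`() = restrict (pderiv P F) A P.
Proof.
have rD p q : restrict (p + q) A P = restrict p A P + restrict q A P.
  exact: mmapD.
have rZ c p : restrict (c *: p) A P = c *: restrict p A P.
  by rewrite /restrict mmapZ mul_polyC.
have rM p q : restrict (p * q) A P = restrict p A P * restrict q A P.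
  exact: rmorphM.
have dM p q : pderiv P (p * q) = pderiv P p * q + p * pderiv P q.
  rewrite /pderiv mulr_suml mulr_sumr -big_split; apply: eq_bigr => i _ /=.
  by rewrite mderivM scalerDr scalerAl scalerAr.
have dZD c p q : pderiv P (c *: p + q) = c *: pderiv P p + pderiv P q.
  rewrite /pderiv scaler_sumr -big_split; apply: eq_bigr => i _ /=.
  by rewrite linearP scalerDr !scalerA mulrC.
have d1 : pderiv P 1 = 0.
  by rewrite /pderiv big1 // => i _; rewrite mderivC scaler0.
have r1 : restrict 1 A P = 1 by exact: rmorph1.
have r0 : restrict 0 A P = 0 by exact: rmorph0.
pose D F := (restrict F A P)^`() = restrict (pderiv P F) A P.
have D1 : D 1 by rewrite /D d1 r1 r0 derivC.
have DM p q : D p -> D q -> D (p * q).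
  by rewrite /D dM rD !rM derivM => -> ->.
have DU i : D (mpolyX R (mnm1 i)).
  rewrite /D {1}/restrict mmapX mmap1U derivD derivC derivZ derivX add0r.
  rewrite /pderiv (bigD1 i) //= big1 => [|j ji].
    rewrite mderivX mnm1E eqxx scale1r addr0 rZ.
    have -> : mnm_sub (mnm1 i) (mnm1 i) = mnm0.
      by apply/mnmP => j; rewrite mnmBE mnm0E subnn.
    by rewrite mpolyX0 r1.
  by rewrite mderivX mnm1E eq_sym (negPf ji) scale0r scaler0.
elim/mpolyind: F => [|c m p _ _ Dp].
  by rewrite r0 deriv0 /pderiv big1 ?r0 // => i _; rewrite mderiv0 scaler0.
rewrite dZD !rD !rZ derivD derivZ Dp; congr (_ *: _ + _).
rewrite -/(D _) mpolyXE_id; elim/big_ind: _ => // i _.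
by elim: (m i) => [|k IH]; rewrite ?expr0 // exprS; exact: DM.
Qed.

(** Bounds on the degrees are carried along with the coefficients, since the
    nominal degree [a] need not be the actual one. *)
Lemma size_coef_mul (p q : {poly R}) (a b : nat) :
  (size p <= a.+1)%N -> (size q <= b.+1)%N ->
  (size (p * q)%R <= (a + b).+1)%N /\ (p * q)`_(a + b) = p`_a * q`_b.
Proof.
move=> sp sq; split.
  by have := size_mul_leq p q; lia.
have lta : (a < (a + b).+1)%N by rewrite ltnS leq_addr.
rewrite coefM (bigD1 (Ordinal lta)) //= addKn big1 ?addr0 // => j.
rewrite -val_eqE /= => ja; case: (ltnP a j) => aj.
  by rewrite nth_default ?mul0r // (leq_trans sp).
rewrite [q`_ _]nth_default ?mulr0 // (leq_trans sq) //; lia.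
Qed.

Lemma restrict_top F A P :
  (size (restrict F A P) <= (pdeg F).+1)%N /\
  (restrict F A P)`_(pdeg F) = peval (ptop F) P.
Proof.
pose l i : {poly R} := (coords A 0 i)%:P + coords P 0 i *: 'X.
have lP i k : (size (l i ^+ k)%R <= k.+1)%N /\
    (l i ^+ k)`_k = coords P 0 i ^+ k.
  elim: k => [|k [IHs IHc]]; first by rewrite !expr0 size_poly1 coef1.
  have sl : (size (l i) <= 2)%N.
    rewrite (leq_trans (size_polyD _ _)) // geq_max.
    rewrite (leq_trans (size_polyC_leq1 _)) //=.
    by rewrite (leq_trans (size_scale_leq _ _)) // size_polyX.
  have [] := size_coef_mul _ _ 1 k sl IHs.
  rewrite -exprS add1n => -> ->; split=> //.
  by rewrite IHc exprS coefD coefC coefZ coefX /= add0r mulr1.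
have mP m : (size (mmap1 l m) <= (mdeg m).+1)%N /\
    (mmap1 l m)`_(mdeg m) = \prod_i coords P 0 i ^+ m i.
  rewrite mdegE /mmap1; elim/big_rec3: _ => [|i c k p _ [sp <-]].
    by rewrite size_poly1 coef1.
  have [ls <-] := lP i (m i); exact: size_coef_mul ls sp.
have supp m : m \in msupp F -> (mdeg m <= pdeg F)%N.
  by move=> /(mmeasure_mnm_lt mdeg); rewrite /pdeg; case: mmeasure.
rewrite /restrict /mmap; split.
  rewrite big_seq; elim/big_ind: _ => [|p q hp hq|m /supp hm].
  - by rewrite size_poly0.
  - by rewrite (leq_trans (size_polyD _ _)) // geq_max hp.
  rewrite mul_polyC (leq_trans (size_scale_leq _ _)) //.
  by have [h _] := mP m; rewrite (leq_trans h).
rewrite /ptop /peval pihomogE raddf_sum /= coef_sum [RHS]big_mkcond /=.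
rewrite big_seq [RHS]big_seq; apply: eq_bigr => m /supp hm.
have [sm cm] := mP m.
rewrite coefCM; case: eqP => [<-|/eqP nm]; first by rewrite cm mevalZ mevalX.
by rewrite nth_default ?mulr0 // (leq_trans sm) // ltn_neqAle nm.
Qed.

(** Taylor's formula at [A] in the direction [P]. *)
Lemma coef_restrict F A P k :
  (restrict F A P)`_k *+ k`! = peval (iter k (pderiv P) F) A.
Proof.
have E : (restrict F A P)^`(k) = restrict (iter k (pderiv P) F) A P.
  by elim: k => [//|k IH]; rewrite derivnS IH deriv_restrict.
have := coef_derivn k (restrict F A P) 0.
rewrite addn0 ffactnn => <-; rewrite E -horner_coef0 horner_restrict.
by rewrite scale0r addr0.
Qed.

Lemma pderivDZ t P Q F : pderiv (P + t *: Q) F = pderiv P F + t *: pderiv Q F.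
Proof.
rewrite /pderiv scaler_sumr -big_split; apply: eq_bigr => i _ /=.
by rewrite coordsE !mxE scalerDl scalerA.
Qed.

Lemma iter_pderiv0 P k : iter k (pderiv P) 0 = 0 :> polyOn W.
Proof.
elim: k => //= k ->; rewrite /pderiv big1 // => i _.
by rewrite mderiv0 scaler0.
Qed.

Lemma pderiv_eq0_pdeg0 F : (forall P, pderiv P F = 0) -> pdeg F = 0%N.
Proof.
move=> dF; have mF i : mderiv i F = 0.
  have := dF (passmx.vecof (vbasis {:W}) (delta_mx 0 i)).
  rewrite /pderiv (bigD1 i) //= vecK big1 => [|j ji].
    by rewrite mxE !eqxx scale1r addr0.
  by rewrite mxE eqxx (negPf ji) scale0r.
suff: (msize F <= 1)%N by rewrite /pdeg; case: mmeasure => // -[].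
rewrite msizeE big_seq; elim/big_ind: _ => // [a b|m].
  by rewrite geq_max => -> ->.
rewrite ltnS leqn0 mcoeff_msupp; apply: contraNT.
rewrite mdeg_eq0 => m0.
have [i mi] : exists i, m i != 0%N.
  apply/existsP; apply: contraNT m0; rewrite negb_exists => /forallP h.
  by apply/eqP/mnmP => i; rewrite mnm0E; apply/eqP/negPn.
have := mcoeff_mderiv i F (mnm_sub m (mnm1 i)).
rewrite mF mcoeff0.
have -> : mnm_add (mnm_sub m (mnm1 i)) (mnm1 i) = m.
  apply/mnmP => j; rewrite mnmDE mnmBE mnm1E subnK //.
  by case: eqP => // <-; rewrite lt0n.
by move=> /esym/eqP; rewrite mulrn_eq0.
Qed.

Lemma pderiv_pdeg0 P F : pdeg F = 0%N -> pderiv P F = 0.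
Proof.
rewrite /pdeg => d0; have : (msize F <= 1)%N by case: mmeasure d0 => // -[].
move=> /msize1_polyC ->; rewrite /pderiv big1 // => i _.
by rewrite mderivC scaler0.
Qed.
End Restriction.

(** * Topology of the space *)

Lemma cvg_meval (R : realType) (n : nat) (T : Type) (U : set_system T)
    (f : 'I_n -> T -> R) (l : 'I_n -> R) (p : mpoly n R) :
  Filter U -> (forall i, f i x @[x --> U] --> l i) ->
  meval (fun i => f i x) p @[x --> U] --> meval l p.
Proof.
move=> FU fl; elim/mpolyind: p => [|c m p _ _ IH].
  under eq_cvg do rewrite meval0.
  by rewrite meval0; exact: cvg_cst.
under eq_cvg do rewrite mevalD mevalZ mevalX.
rewrite mevalD mevalZ mevalX; apply: cvgD IH; apply: cvgMl_tmp.
apply: cvg_big => [|i _]; first exact: mul_continuous.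
elim: (m i) => [|k IHk]; first exact: cvg_cst.
under eq_cvg do rewrite exprS.
by rewrite exprS; exact: cvgM.
Qed.

Section Topology.
Context {R : realType} {W : vectType R}.
Implicit Types (F : polyOn W) (A B P Q : W) (t : R).

Lemma peval_continuous F : continuous (peval F : vtop W -> R).
Proof.
move=> A; have FA := nbhs_filter (A : vtop W).
apply: (@cvg_meval _ _ (vtop W) _ _ _ _ FA) => i.
apply: (@continuous_comp (vtop W) _ _ (@coords R W) (fun v => v 0 i)).
  exact: initial_continuous.
exact: coord_continuous.
Qed.

Lemma positivity_set_nbhs F A :
  0 < peval F A -> nbhs (A : vtop W) (positivity_set F).
Proof. by move=> /lt_nbhsr /(peval_continuous F A). Qed.

Lemma line_continuous A B :
  continuous ((fun t : R => A + t *: B) : R -> vtop W).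
Proof.
apply: continuous_comp_initial => t.
have -> : @coords R W \o (fun t => A + t *: B) =
   (fun t => coords A + t *: coords B).
  by apply: funext => s /=; rewrite coordsE.
apply: cvgD; first exact: cvg_cst.
by apply: cvgZr_tmp; exact: cvg_id.
Qed.

(** Local convexity, in the only form needed: the preimage of a ball around
    [coords A] is star-shaped at [A]. *)
Lemma star_nbhs (U : set (vtop W)) A : nbhs (A : vtop W) U ->
  exists2 N : set (vtop W), nbhs (A : vtop W) N /\ N `<=` U &
    forall B t, N B -> 0 <= t <= 1 -> N (A + t *: (B - A)).
Proof.
case=> [? [[O oO <-] OA] sU].
have /nbhs_ballP[e /= e0 be] : nbhs (coords A) O by exact: open_nbhs_nbhs.
exists (@coords R W @^-1` ball (coords A) e).
  split; last by move=> B /be /sU.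
  apply: (@initial_continuous _ _ (@coords R W)).
  exact: nbhsx_ballx.
move=> B t; rewrite /preimage /= -!ball_normE /ball_ /= => Be /andP[t0 t1].
rewrite coordsE opprD addNKr normrN normrZ ger0_norm //.
have -> : coords (B - A) = coords B - coords A.
  by rewrite -[- A]scaleN1r coordsE scaleN1r.
by rewrite distrC (le_lt_trans _ Be) // ler_piMl.
Qed.

(** The component is given through any of its points [A'], as conic components
    are. *)
Lemma segment_in_component F (C : set W) A B :
  (exists2 A' : W, positivity_set F A' &
     C = connected_component (positivity_set F : set (vtop W)) A') ->
  C A -> (forall t, 0 <= t <= 1 -> 0 < peval F (A + t *: (B - A))) -> C B.
Proof.
move=> [A' _ ->] CA pos.
apply: (@connected_component_trans (vtop W) _ A) => //.
exists ((fun t : R => A + t *: (B - A)) @` `[0, 1]).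
  split.
  - by exists 0; rewrite ?scale0r ?addr0 //= in_itv /= lexx ler01.
  - by move=> _ [t /= + <-]; rewrite in_itv /= => /pos.
  - apply: connected_continuous_connected; first exact: segment_connected.
    by apply: continuous_subspaceT; exact: line_continuous.
exists 1; first by rewrite /= in_itv /= lexx ler01.
by rewrite scale1r addrC subrK.
Qed.
End Topology.

(** * Polynomials that are Garding for a set of directions *)

Section Garding.
Context {R : realType} {W : vectType R} (K : set W).
Implicit Types (F : polyOn W) (A B P Q : W) (t : R).

Lemma conic_setP F : garding K F -> conic_component K F (conic_set K F).
Proof. by case=> {}F _ [C hC] _ _; apply: (@xgetPex _ set0); exists C. Qed.

Lemma conic_set_gt0 F A : garding K F -> conic_set K F A -> 0 < peval F A.
Proof.
by move=> /conic_setP[[A' _ ->] _] /(@connected_component_sub (vtop W)).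
Qed.

Lemma conic_set_neq0 F : garding K F -> conic_set K F !=set0.
Proof.
move=> /conic_setP[[A FA ->] _]; exists A.
exact: (@connected_component_refl (vtop W)).
Qed.

Lemma conic_setD F A P :
  garding K F -> conic_set K F A -> K P -> conic_set K F (A + P).
Proof. by move=> /conic_setP[_]; apply. Qed.

Lemma garding_pderiv F P : garding K F -> K P -> pderiv P F != 0 ->
  garding K (pderiv P F) /\ conic_set K F `<=` conic_set K (pderiv P F).
Proof.
case=> {}F _ _ gd sub KP dF.
have d1 : (1 <= pdeg F)%N.
  by rewrite lt0n; apply: contraNneq dF => /pderiv_pdeg0 ->.
by split; [exact: gd | exact: sub].
Qed.

(** Each derivative in the direction [P] is zero or Garding, and conic
    components grow along derivatives, so [A] remains in all of them. *)
Lemma pderivn_ge0 F A P k : garding K F -> conic_set K F A -> K P ->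
  0 <= peval (iter k (pderiv P) F) A.
Proof.
move=> + + KP; elim: k F => [|k IH] F gF FA; first exact/ltW/conic_set_gt0.
rewrite iterSr; have [d0|d0] := eqVneq (pderiv P F) 0.
  by rewrite d0 iter_pderiv0 /peval meval0.
have [gd sub] := garding_pderiv _ _ gF KP d0.
by apply: IH => //; exact: sub.
Qed.

(** On [C_F^(1)] nothing is known about the sign of [F] itself, hence the
    constant coefficient is left out. *)
Lemma coef_restrict_ge0 F A P k : garding K F -> conic_set1 K F A -> K P ->
  0 <= (restrict F A P)`_k.+1.
Proof.
move=> gF FA KP; rewrite -(pmulrn_lge0 _ (fact_gt0 k.+1)) coef_restrict.
rewrite iterSr; have [d0|d0] := eqVneq (pderiv P F) 0.
  by rewrite d0 iter_pderiv0 /peval meval0.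
have [gd _] := garding_pderiv _ _ gF KP d0.
by apply: pderivn_ge0 => //; exact: FA.
Qed.

(** The increment is the sum of all the nonconstant terms of the restriction,
    and these are nonnegative: it dominates each of them. *)
Lemma coef_le_increment F A P t k : garding K F -> conic_set1 K F A -> K P ->
  0 <= t -> (k < pdeg F)%N ->
  (restrict F A P)`_k.+1 * t ^+ k.+1 <= peval F (A + t *: P) - peval F A.
Proof.
move=> gF FA KP t0 kd; have [sz _] := restrict_top F A P.
have E : peval F A = (restrict F A P)`_0.
  by rewrite -horner_coef0 horner_restrict scale0r addr0.
rewrite -horner_restrict (horner_coef_wide _ sz) big_ord_recl E /= expr0 mulr1.
rewrite addrC addKr (bigD1 (Ordinal kd)) //= lerDl sumr_ge0 // => i _.
by rewrite mulr_ge0 ?exprn_ge0 // coef_restrict_ge0.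
Qed.

Lemma peval_conic_set1_le F A P t : garding K F -> (1 <= pdeg F)%N ->
  conic_set1 K F A -> K P -> 0 <= t -> peval F A <= peval F (A + t *: P).
Proof.
move=> gF d1 FA KP t0; rewrite -subr_ge0.
apply: le_trans (coef_le_increment _ _ _ _ _ gF FA KP t0 d1).
by rewrite mulr_ge0 ?exprn_ge0 // coef_restrict_ge0.
Qed.

Lemma ptop_le_increment F A P : garding K F -> (1 <= pdeg F)%N ->
  conic_set1 K F A -> K P -> peval (ptop F) P <= peval F (A + P) - peval F A.
Proof.
move=> gF d1 FA KP; have [_ <-] := restrict_top F A P.
have lt : ((pdeg F).-1 < pdeg F)%N by rewrite prednK.
have := coef_le_increment _ _ _ _ _ gF FA KP ler01 lt.
by rewrite expr1n mulr1 scale1r prednK.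
Qed.

Lemma conic_set1D F A P : garding K F ->
  conic_set1 K F A -> K P -> conic_set1 K F (A + P).
Proof.
move=> gF FA KP Q [KQ dQ]; have [gd _] := garding_pderiv _ _ gF KQ dQ.
by apply: conic_setD => //; exact: FA.
Qed.

Lemma sub_conic_set1 F : garding K F -> conic_set K F `<=` conic_set1 K F.
Proof.
by move=> gF A FA P [KP dP]; have [_] := garding_pderiv _ _ gF KP dP; apply.
Qed.

(** A component of the open set [{F > 0}] is open: a star-shaped neighbourhood
    of [A] on which [F > 0] is joined to [A] by segments. *)
Lemma conic_set_nbhs F A : garding K F -> conic_set K F A ->
  nbhs (A : vtop W) (conic_set K F).
Proof.
move=> gF FA; have [comp _] := conic_setP _ gF.
have : nbhs (A : vtop W) (positivity_set F).
  by apply: positivity_set_nbhs; exact: conic_set_gt0 FA.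
move=> /star_nbhs[N [NA sN] star]; apply: filterS NA => B NB.
apply: segment_in_component comp FA _ => t t01; exact/sN/star.
Qed.

Section Generating.
Context (generatingK : forall B, exists P Q, [/\ K P, K Q & B = P - Q]).

Lemma conic_ray_test_meet (U U' : set W) :
  conic_ray_test K U -> conic_ray_test K U' -> U !=set0 -> U' !=set0 ->
  U `&` U' !=set0.
Proof.
move=> rU rU' [A UA] [B UB]; have [P [Q [KP KQ E]]] := generatingK (B - A).
exists (A + P); split; first exact: rU.
suff -> : A + P = B + Q by exact: rU'.
by rewrite -(subrK A B) E addrAC subrK addrC.
Qed.

(** From [A] in [C_F^(1)] with [F(A) > 0], the value of [F] does not decrease
    on the segment to some [A + P], which can be chosen in [C_F] because [K]
    generates the space. *)
Lemma conic_set1_gt0 F : garding K F -> (1 <= pdeg F)%N ->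
  conic_set1 K F `&` positivity_set F = conic_set K F.
Proof.
move=> gF d1; apply/seteqP; split=> A; last first.
  move=> FA; split; first exact: sub_conic_set1.
  exact: conic_set_gt0 FA.
move=> [FA posA]; have [comp _] := conic_setP _ gF.
have [B FB] := conic_set_neq0 _ gF.
have [P [Q [KP KQ E]]] := generatingK (B - A).
have FAP : conic_set K F (A + P).
  suff -> : A + P = B + Q by exact: conic_setD.
  by rewrite -(subrK A B) E addrAC subrK addrC.
apply: segment_in_component comp FAP _ => t /andP[_ t1].
have -> : A + P + t *: (A - (A + P)) = A + (1 - t) *: P.
  by rewrite opprD addNKr scalerN scalerBl scale1r addrA.
apply: lt_le_trans posA _; apply: peval_conic_set1_le => //.
by rewrite subr_ge0.
Qed.

Definition order_unit P := forall Q, exists t, K (t *: P - Q).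

(** If [d_P F = 0] then [d_Q F] and [d_(tP - Q) F] are opposite. Were they
    nonzero, they would both be positive at a common point of their conic
    components. *)
Lemma pderiv_order_unit_neq0 F P : garding K F -> (1 <= pdeg F)%N ->
  order_unit P -> pderiv P F != 0.
Proof.
move=> gF d1 uP; apply/eqP => dP.
suff dK Q : K Q -> pderiv Q F = 0.
  have dB B : pderiv B F = 0.
    have [Q [Q' [KQ KQ' ->]]] := generatingK B.
    by rewrite -[- Q']scaleN1r pderivDZ !dK // scaler0 addr0.
  by rewrite (pderiv_eq0_pdeg0 _ dB) in d1.
move=> KQ; apply/eqP/negPn/negP => dQ.
have [t KtQ] := uP Q.
have dE : pderiv (t *: P - Q) F = - pderiv Q F.
  rewrite -[- Q]scaleN1r pderivDZ scaleN1r -[t *: P]add0r pderivDZ dP scaler0.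
  have := pderivDZ (-1) 0 0 F.
  by rewrite scaler0 addr0 scaleN1r subrr => ->; rewrite addr0 add0r.
have dN : pderiv (t *: P - Q) F != 0 by rewrite dE oppr_eq0.
have [g1 _] := garding_pderiv _ _ gF KQ dQ.
have [g2 _] := garding_pderiv _ _ gF KtQ dN.
have [||||B [B1 B2]] :=
    conic_ray_test_meet (conic_set K (pderiv Q F))
                        (conic_set K (pderiv (t *: P - Q) F)).
- by have [] := conic_setP _ g1.
- by have [] := conic_setP _ g2.
- exact: conic_set_neq0.
- exact: conic_set_neq0.
have := conic_set_gt0 _ _ g2 B2; rewrite dE /peval mevalN oppr_gt0.
by apply/negP; rewrite -leNgt ltW //; exact: conic_set_gt0 g1 B1.
Qed.

Lemma peval_order_unit_lt F A P : garding K F -> (1 <= pdeg F)%N ->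
  conic_set1 K F A -> K P -> order_unit P -> peval F A < peval F (A + P).
Proof.
move=> gF d1 FA KP uP; rewrite -subr_gt0.
have dP := pderiv_order_unit_neq0 _ _ gF d1 uP.
have [gd _] := garding_pderiv _ _ gF KP dP.
have := coef_le_increment _ _ _ _ _ gF FA KP ler01 d1.
rewrite expr1n mulr1 scale1r; apply: lt_le_trans.
have -> : (restrict F A P)`_1 = peval (pderiv P F) A.
  by rewrite -(coef_restrict F A P 1) mulr1n.
by apply: conic_set_gt0 gd _; exact: FA.
Qed.

(** If [F(A) > 0], a star-shaped neighbourhood of [A] in [{F > 0}] contains a
    point of [C_F^(1)], which is then in [C_F]; so [A] is in the open set [C_F],
    inside the interior of [C_F^(1)]. *)
Lemma peval_boundary_le0 F A : garding K F -> (1 <= pdeg F)%N ->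
  boundary (interior (conic_set1 K F : set (vtop W))) (A : vtop W) ->
  peval F A <= 0.
Proof.
move=> gF d1 [clA nA]; rewrite leNgt; apply/negP => FA; apply: nA.
have [comp _] := conic_setP _ gF.
have : nbhs (A : vtop W) (positivity_set F).
  exact: positivity_set_nbhs.
move=> /star_nbhs[N [NA sN] star].
have [B [intB NB]] := clA _ NA.
have FB : conic_set K F B.
  rewrite -(conic_set1_gt0 _ gF d1); split; last exact: sN.
  exact: interior_subset intB.
have FA' : conic_set K F A.
  apply: segment_in_component comp FB _ => t /andP[t0 t1].
  have -> : B + t *: (A - B) = A + (1 - t) *: (B - A).
    by rewrite scalerBl scale1r addrA [A + (B - A)]addrC subrK -scalerN opprB.
  by apply/sN/star => //; rewrite subr_ge0 t1 gerBl.
apply: nbhs_interior; apply: filterS (conic_set_nbhs _ _ gF FA').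
exact: sub_conic_set1.
Qed.
End Generating.

Lemma interior_conic_set1D F A P : garding K F ->
  interior (conic_set1 K F : set (vtop W)) A -> K P ->
  interior (conic_set1 K F : set (vtop W)) (A + P).
Proof.
move=> gF iA KP.
have ct : continuous (fun v : 'rV[R]_(\dim {:W}) => v - coords P).
  move=> v; have Fv := nbhs_filter v.
  by apply: cvgB; [exact: cvg_id | exact: cvg_cst].
have c : continuous ((fun B => B - P) : vtop W -> vtop W).
  apply: continuous_comp_initial => B.
  rewrite (_ : _ \o _ = (fun v => v - coords P) \o @coords R W); last first.
    by apply: funext => C /=; rewrite -scaleN1r coordsE scaleN1r.
  apply: (@continuous_comp (vtop W) _ _ (@coords R W) (fun v => v - coords P)).
    exact: initial_continuous.
  exact: ct.
have : nbhs ((A + P : W) : vtop W) ((fun B => B - P) @^-1` conic_set1 K F).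
  by apply: c; rewrite /= addrK.
by apply: filterS => B /= FB; rewrite -(subrK P B); exact: conic_set1D.
Qed.

End Garding.

(** * The cone of semipositive Hermitian forms *)

Section Hermitian.
Context {R : realType} {V : vectType R[i]}.
Implicit Types (B P Q : hform V) (u v w : V) (z : R[i]).
Let n := \dim {:V}.
Let e (i : 'I_n) : V := (vbasis {:V})`_i.
Let x (u : V) (i : 'I_n) : R[i] := coord (vbasis {:V}) i u.

Lemma hform0l B v : B 0 v = 0.
Proof.
have := hform_linearl B v (-1) 0 0.
by rewrite scaler0 addr0 mulN1r addNr.
Qed.

Lemma hform_suml B v (a : 'I_n -> R[i]) (y : 'I_n -> V) :
  B (\sum_i a i *: y i) v = \sum_i a i * B (y i) v.
Proof.
apply: (big_rec2 (fun q p => B q v = p)) => [|i q p _ <-]; last first.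
  exact: hform_linearl.
exact: hform0l.
Qed.

Lemma hform_sumr B v (a : 'I_n -> R[i]) (y : 'I_n -> V) :
  B v (\sum_i a i *: y i) = \sum_i (a i)^* * B v (y i).
Proof.
rewrite hformC hform_suml rmorph_sum; apply: eq_bigr => i _.
by rewrite rmorphM /= -hformC.
Qed.

Lemma vbasis_expand v : v = \sum_i x v i *: e i.
Proof. by apply: coord_vbasis; rewrite memvf. Qed.

Lemma hform_expand B u v :
  B u v = \sum_i \sum_j x u i * ((x v j)^* * B (e i) (e j)).
Proof.
rewrite {1}[u]vbasis_expand hform_suml; apply: eq_bigr => i _.
by rewrite {1}[v]vbasis_expand hform_sumr mulr_sumr.
Qed.

Lemma hform_real B v : B v v \is Num.real.
Proof. by rewrite CrealE -hformC. Qed.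

(** The Riesz representation of a coordinate form: the Gram matrix of a
    definite form is invertible. *)
Lemma coord_riesz P k : positive P -> exists w, forall v, P v w = x v k.
Proof.
move=> posP; pose M : 'M[R[i]]_n := \matrix_(i, j) P (e i) (e j).
have uM : M \in unitmx.
  rewrite -row_free_unit; apply: inj_row_free => u uM0.
  pose v := \sum_j u 0 j *: e j.
  have Pve j : P v (e j) = 0.
    have := congr1 (fun N : 'rV_n => N 0 j) uM0; rewrite !mxE => <-.
    by rewrite hform_suml; apply: eq_bigr => l _; rewrite mxE.
  have Pvv : P v v = 0.
    by rewrite {2}/v hform_sumr big1 // => j _; rewrite Pve mulr0.
  have v0 : v = 0.
    by apply/eqP/negPn/negP => /posP; rewrite Pvv ltxx.
  apply/rowP => j; rewrite mxE.
  rewrite -(coord_sum_free (u 0) j (basis_free (vbasisP {:V}))).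
  by rewrite -[X in coord _ _ X]/v v0 linear0.
exists (\sum_j (invmx M j k)^* *: e j) => v.
have Pe i : P (e i) (\sum_j (invmx M j k)^* *: e j) = (i == k)%:R.
  have := congr1 (fun N : 'M_n => N i k) (mulmxV uM); rewrite !mxE => <-.
  by rewrite hform_sumr; apply: eq_bigr => j _; rewrite conjCK mxE mulrC.
rewrite {1}[v]vbasis_expand hform_suml (bigD1 k) //= Pe eqxx mulr1.
by rewrite big1 ?addr0 // => i ik; rewrite Pe (negPf ik) mulr0.
Qed.

Lemma positive_semipositive P : positive P -> semipositive P.
Proof.
move=> posP v; have [->|/posP/ltW //] := eqVneq v 0.
by rewrite hform0l.
Qed.

(** The Cauchy-Schwarz inequality for [v] and the vector [w] representing the
    [k]-th coordinate, with [s = P(w, w)]. *)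
Lemma normsq_coord_le P k : positive P ->
  exists2 s, 0 < s & forall v, `|x v k| ^+ 2 <= s * P v v.
Proof.
move=> posP; have [w Pw] := coord_riesz P k posP.
have s0 : 0 < P w w.
  apply: posP; apply: contra_eq_neq (Pw (e k)) => ->.
  rewrite /x /e coord_free ?eqxx ?(basis_free (vbasisP _)) //.
  by rewrite hformC hform0l conjC0 eq_sym oner_eq0.
exists (P w w) => // v.
(* [a *: w] is the P-orthogonal projection of [v] on the line of [w]. *)
pose a := x v k / P w w.
have sC : (P w w)^* = P w w by rewrite -hformC.
have E : P (v - a *: w) (v - a *: w) = P v v - `|x v k| ^+ 2 / P w w.
  have linl y : P (v - a *: w) y = P v y - a * P w y.
    by rewrite addrC -scaleNr hform_linearl mulNr addrC.
  have linr y : P y (v - a *: w) = P y v - a^* * P y w.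
    rewrite hformC addrC -scaleNr hform_linearl rmorphD rmorphM rmorphN /=.
    by rewrite -!hformC mulNr addrC.
  rewrite linl !linr [P w v]hformC (Pw v) normCK /a rmorphM /= fmorphV /= sC.
  by field; exact: lt0r_neq0.
have := positive_semipositive P posP (v - a *: w).
by rewrite E subr_ge0 ler_pdivrMr // mulrC.
Qed.

(** The form [Q] is bounded by its coefficients and the squared coordinates,
    which are themselves bounded by [P]. *)
Lemma positive_order_unit P : positive P -> order_unit (@semipositive R V) P.
Proof.
move=> posP Q.
have /choice[s s_spec] : forall k, exists s,
    0 < s /\ forall v, `|x v k| ^+ 2 <= s * P v v.
  by move=> k; have [s s0 h] := normsq_coord_le P k posP; exists s.
pose T := \sum_i \sum_j `|Q (e i) (e j)| * (s i + s j).
have T0 : 0 <= T.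
  apply: sumr_ge0 => i _; apply: sumr_ge0 => j _.
  have [[si _] [sj _]] := (s_spec i, s_spec j).
  by rewrite mulr_ge0 // addr_ge0 // ltW.
exists (complex.Re T) => v; change (0 <= (complex.Re T)%:C%C * P v v - Q v v).
rewrite RRe_real ?ger0_real // subr_ge0.
rewrite (le_trans (real_ler_norm (hform_real Q v))) //.
rewrite hform_expand (le_trans (ler_norm_sum _ _ _)) // mulr_suml.
apply: ler_sum => i _; rewrite (le_trans (ler_norm_sum _ _ _)) // mulr_suml.
apply: ler_sum => j _; have [[_ si] [_ sj]] := (s_spec i, s_spec j).
rewrite !normrM norm_conjC mulrA mulrC -mulrA ler_wpM2l //.
rewrite mulrDl (le_trans _ (lerD (si v) (sj v))) //.
have := normr_ge0 (x v i); have := normr_ge0 (x v j).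
have /orP[] := real_leVge (normr_real (x v i)) (normr_real (x v j)).
  move=> ij j0 i0; rewrite !expr2 ler_wpDl ?mulr_ge0 //.
  exact: ler_wpM2r.
move=> ij j0 i0; rewrite !expr2 ler_wpDr ?mulr_ge0 //.
exact: ler_wpM2l.
Qed.

Lemma positive_gram_form1 : positive (gram_form 1%:M : hform V).
Proof.
move=> v v0.
have -> : gram_form 1%:M v v = \sum_i `|x v i| ^+ 2.
  apply: eq_bigr => i _; rewrite (bigD1 i) //= big1 ?addr0 => [|j ji].
    by rewrite /gram_entry eqxx mxE eqxx mulr1 normCK.
  rewrite /gram_entry eq_sym (negPf ji) !mxE eq_sym (negPf ji) oppr0.
  by rewrite [if _ then _ else _]if_same mulr0.
rewrite lt0r sumr_ge0 => [|i _]; last exact: exprn_ge0.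
rewrite andbT; apply: contra v0.
rewrite psumr_eq0 => [/allP h|i _]; last exact: exprn_ge0.
rewrite [v]vbasis_expand big1 // => i _.
have := h i (mem_index_enum _).
by rewrite expf_eq0 normr_eq0 => /eqP ->; rewrite scale0r.
Qed.

(** The scalar [t] given by the order unit [E] may be negative, hence the
    correction by [(`|t| - t) E]. *)
Lemma semipositive_generating (B : hform V) :
  exists P Q, [/\ semipositive P, semipositive Q & B = P - Q].
Proof.
have posE := positive_gram_form1; set E := gram_form _ in posE.
have [t KtB] := positive_order_unit E posE (- B).
have KE := positive_semipositive E posE.
have scaleE (r : R) : 0 <= r -> semipositive (r *: E).
  by move=> r0 v; rewrite hformZ mulr_ge0 // lecR.
exists (t *: E + B + (`|t| - t) *: E), (`|t| *: E); split.
- move=> v; rewrite hformD addr_ge0 //; first by have := KtB v; rewrite opprK.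
  by apply: scaleE; rewrite subr_ge0 ler_norm.
- exact: scaleE.
- by rewrite scalerBl addrA addrAC addrK addrC addKr.
Qed.
End Hermitian.

(** * Conclusion *)

Lemma limf_esup_le (T : topologicalType) (R : realType) (f : T -> R)
    (D : set T) (a : T) (l : R) :
  {for a, continuous f} -> f a <= l ->
  (limf_esup (fun x => (f x)%:E) (within D (nbhs a)) <= l%:E)%E.
Proof.
move=> fa fl; apply/lee_addgt0Pr => e e0.
have N : nbhs a [set x | f x < l + e].
  have /lt_nbhsl/fa : f a < l + e by rewrite (le_lt_trans fl) // ltrDl.
  exact.
apply: (@le_trans _ _
    (ereal_sup ((fun x => (f x)%:E) @` [set x | f x < l + e]))).
  apply: ereal_inf_lbound; exists [set x | f x < l + e] => //.
  by apply: filterS N.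
by apply: ge_ereal_sup => _ [x /= fx <-]; rewrite -EFinD lee_fin ltW.
Qed.

Theorem proposition4p13 (R : realType) (V : vectType R[i])
    (G : polyOn (hform V)) (hG : garding_elliptic G) (hd : (1 <= pdeg G)%N) :
  (* (A1) *)
  (admissible G !=set0 /\
   (forall A P : hform V,
      admissible G A -> semipositive P -> admissible G (A + P)))
  (* (A2) *)
  /\ (forall A P : hform V,
        admissible G A -> positive P -> peval G A < peval G (A + P))
  (* (A3) *)
  /\ (forall A0 : vtop (hform V), boundary (admissible G) A0 ->
        (limf_esup (fun A : vtop (hform V) => (peval G A)%:E)
           (within (admissible G) (nbhs A0)) <= 0)%E)
  /\ (forall A P : hform V, elliptic_set1 G A -> semipositive P ->
        peval (ptop G) P <= peval G (A + P) - peval G A)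
  /\ elliptic_set1 G `&` positivity_set G = elliptic_set G.
Proof.
have gen := @semipositive_generating R V.
split; [split|split; [|split; [|split]]].
- have [A GA] := conic_set_neq0 _ _ hG; exists A.
  apply: filterS (conic_set_nbhs _ _ _ hG GA); exact: sub_conic_set1.
- by move=> A P iA sP; exact: interior_conic_set1D.
- move=> A P /interior_subset GA posP.
  apply: (peval_order_unit_lt _ gen _ _ _ hG) => //.
    exact: positive_semipositive.
  exact: positive_order_unit.
- move=> A0 bA0; apply: limf_esup_le; first exact: peval_continuous.
  exact: (peval_boundary_le0 _ gen _ _ hG).
- by move=> A P GA sP; exact: (ptop_le_increment _ _ _ _ hG hd GA sP).
- exact: (conic_set1_gt0 _ gen _ hG hd).
Qed.
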